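(* Let $G$ be a graph with convex balls and let $uvw$ be a metric triangle of $G$ with $d(u,v)\le d(u,w)\le d(v,w)$. Then either $uvw$ is strongly equilateral, or $uvw$ has type $(2,2,1)$ and there are vertices $x,y$ such that $u\sim v\sim x\sim w\sim y\sim u$ is a pentagon (induced $5$-cycle) of $G$.
   Context: Graphs are simple, undirected, connected, with all cliques finite; $d$ is the graph distance, $I(a,b)=\{z:d(a,z)+d(z,b)=d(a,b)\}$; $G$ has convex balls if each ball $B_r(a)$ contains every vertex on a shortest path between two of its vertices. Three vertices $u,v,w$ form a metric triangle if $I(u,v)\cap I(u,w)=\{u\}$, $I(u,v)\cap I(v,w)=\{v\}$ and $I(u,w)\cap I(v,w)=\{w\}$. It has type $(k_1,k_2,k_3)$ if its side lengths are $k_1\ge k_2\ge k_3$; it is equilateral if all three sides have the same length, and strongly equilateral if, in addition to being a metric triangle, for each vertex all vertices of the interval between the two other vertices have the same distance to it (e.g. $d(u,x)=d(u,v)$ for all $x\in I(v,w)$, and symmetrically). *)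

(* Defs.v *)
From mathcomp Require Import all_boot all_order all_classical.
Set Implicit Arguments.
Unset Strict Implicit.
Unset Printing Implicit Defensive.

Local Open Scope classical_set_scope.

(* Simple undirected connected graphs, possibly infinite, in which every clique
   is finite.  A walk from [x] is given by the list [p] of its vertices after
   [x], so its length is [size p]. *)
Record graph := Graph {
  vertex :> Type;
  adj : rel vertex;
  adj_sym : symmetric adj;
  adj_irrefl : irreflexive adj;
  adj_connected : forall x y : vertex, exists p, path adj x p /\ last x p = y;
  finite_cliques : forall C : set vertex,
    (forall x y, C x -> C y -> x <> y -> adj x y) -> finite_set C
}.

Section Definitions.
Variable G : graph.
Implicit Types (u v w x y : G) (r n : nat).

Definition has_walk x y : pred nat :=
  fun n => `[< exists p, [/\ path (@adj G) x p, last x p = y & size p = n] >].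

Lemma has_walk_ex x y : exists n, has_walk x y n.
Proof.
have [p [xp py]] := adj_connected x y.
by exists (size p); apply/asboolP; exists p.
Qed.

Definition dist x y : nat := ex_minn (has_walk_ex x y).

Definition interval x y : set G :=
  [set z | dist x z + dist z y = dist x y].

Definition ball r x : set G := [set z | dist x z <= r].

Definition convex_balls : Prop :=
  forall r x, forall y z, ball r x y -> ball r x z -> interval y z `<=` ball r x.

Definition metric_triangle u v w : Prop :=
  [/\ interval u v `&` interval u w = [set u],
      interval u v `&` interval v w = [set v] &
      interval u w `&` interval v w = [set w]].

Definition triangle_type u v w : seq nat :=
  sort geq [:: dist u v; dist u w; dist v w].

Definition equidistant u (A : set G) : Prop :=
  forall x y, A x -> A y -> dist u x = dist u y.

(* The side lengths are then automatically equal, since the endpoints [x] and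
   [y] belong to [interval x y]. *)
Definition strongly_equilateral u v w : Prop :=
  [/\ metric_triangle u v w,
      equidistant u (interval v w),
      equidistant v (interval u w) &
      equidistant w (interval u v)].

Definition induced_cycle n (f : 'I_n -> G) : Prop :=
  injective f /\
  forall i j, adj (f i) (f j) = (j == ordS i) || (i == ordS j).

Definition pentagon (a b c d e : G) : Prop :=
  induced_cycle (tnth [tuple a; b; c; d; e]).

End Definitions.

(* Main.v *)
(* Convexity of balls gives two local tools: the neighbors of v on geodesics
   from v to u form a clique, and an edge x y equidistant from u has a
   common neighbor closer to u or lies on a pentagon whose opposite vertex
   is two steps closer to u (otherwise the geodesics from u could be rotated
   around a long odd isometric cycle).

   A metric triangle a b c that is not strongly equilateral has, for some
   choice of the apex a with d(a,b) >= d(a,c), a vertex y of I(b,c) closer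
   to a than b is. Choose y closest to b and induct on the perimeter, the
   induction hypothesis being that smaller metric triangles are equilateral
   or of type (2,2,1). The last edges of a geodesic from b to y lie on a
   pentagon meeting I(y,a) in a neighbor z of y with d(b,z) = d(b,y). If
   d(b,y) >= 3, then I(b,a) and I(b,z) meet only in b, so a quasi-median of
   a, b, z has two sides whose lengths differ by at least 2, which is
   impossible. If d(b,y) = 2, the pentagon sits at the corner b, with one
   vertex on each side; quasi-medians obtained by moving b along the
   pentagon leave only the types (2,2,1) and (3,3,2), and the latter is
   excluded directly. *)

Require Import Defs.
From mathcomp Require Import all_boot all_order all_classical.
From mathcomp Require Import zify.
Set Implicit Arguments.
Unset Strict Implicit.
Unset Printing Implicit Defensive.

Local Open Scope classical_set_scope.

(** * Graph distance and walks *)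

Section Distance.
Variable G : graph.
Implicit Types x y z : G.

Lemma dist_le_walk x p : path (@adj G) x p -> dist x (last x p) <= size p.
Proof.
move=> xp; rewrite /dist; case: ex_minnP => n _; apply.
by apply/asboolP; exists p.
Qed.

Lemma dist_walk x y :
  exists p, [/\ path (@adj G) x p, last x p = y & size p = dist x y].
Proof. by rewrite /dist; case: ex_minnP => n /asboolP. Qed.

Lemma dist_triangle y x z : dist x z <= dist x y + dist y z.
Proof.
have [p [xp py <-]] := dist_walk x y; have [q [yq qz <-]] := dist_walk y z.
rewrite -size_cat -qz -py -last_cat; apply: dist_le_walk.
by rewrite cat_path xp py.
Qed.

Lemma dist_sym x y : dist x y = dist y x.
Proof.
suff le (u v : G) : dist u v <= dist v u by apply/eqP; rewrite eqn_leq !le.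
have [p [vp pu <-]] := dist_walk v u.
have rp : path (@adj G) u (rev (belast v p)).
  by rewrite -pu rev_path; apply: sub_path vp => s t; rewrite adj_sym.
have lr : last u (rev (belast v p)) = v.
  by case: p pu {rp vp} => [|s p] //= _; rewrite rev_cons last_rcons.
by have := dist_le_walk rp; rewrite lr size_rev size_belast.
Qed.

Lemma distxx x : dist x x = 0.
Proof. by apply/eqP; rewrite -leqn0; apply: (@dist_le_walk x [::]). Qed.

Lemma dist0_eq x y : dist x y = 0 -> x = y.
Proof. by have [p [_ <- <-]] := dist_walk x y; move/size0nil ->. Qed.

Lemma adj_dist x y : adj x y = (dist x y == 1).
Proof.
apply/idP/eqP => [xy|].
  have : dist x y <= 1.
    by apply: (@dist_le_walk x [:: y]); rewrite /= xy.
  case E: (dist x y) => [|[|]] // _.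
  by move: xy; rewrite (dist0_eq E) adj_irrefl.
have [p [xp <- <-]] := dist_walk x y.
by case: p xp => [|s [|]] //= /andP[].
Qed.

Lemma dist_split n x y : n <= dist x y ->
  exists z, dist x z = n /\ n + dist z y = dist x y.
Proof.
move=> le_n; have [p [xp py sp]] := dist_walk x y.
exists (last x (take n p)).
move: xp py; rewrite -{1 2}(cat_take_drop n p) cat_path last_cat.
case/andP=> xt td dy.
have := dist_le_walk xt; have := dist_le_walk td; rewrite dy.
rewrite size_takel ?size_drop ?sp //.
have := dist_triangle (last x (take n p)) x y; lia.
Qed.

Lemma exists_farthest (P : G -> Prop) (f : G -> nat) N x :
  P x -> (forall z, P z -> f z <= N) ->
  exists2 z, P z & forall s, P s -> f s <= f z.
Proof.
move=> Px le_N; pose Q n := `[< exists2 z, P z & f z = n >].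
have exQ : exists n, Q n by exists (f x); apply/asboolP; exists x.
have ubQ n : Q n -> n <= N by move=> /asboolP[z Pz <-]; apply: le_N.
case: (ex_maxnP exQ ubQ) => n /asboolP[z Pz <-] maxz.
by exists z => // s Ps; apply: maxz; apply/asboolP; exists s.
Qed.

End Distance.

(** Feeds [lia] the three triangle inequalities and the symmetries among three vertices; most metric
    steps below are linear arithmetic over such instances. *)
Ltac tri a b c :=
  have := dist_triangle a b c; have := dist_triangle b a c;
  have := dist_triangle c a b;
  have := dist_sym a b; have := dist_sym b c; have := dist_sym a c.

(** * Intervals and quasi-medians *)

Section Geodesics.
Variable G : graph.
Implicit Types a b c x y z u v : G.

(* [I(a, b)] and [I(a, c)] meet only in [a]. *)
Definition apart a b c : Prop :=
  forall z, dist a z + dist z b = dist a b -> dist a z + dist z c = dist a c ->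
  dist a z = 0.

Lemma apart_sym a b c : apart a b c -> apart a c b.
Proof. by move=> h z ? ?; apply: h. Qed.

Lemma interval_setI1 a b c :
  interval a b `&` interval a c = [set a] -> apart a b c.
Proof.
move=> e z zb zc; suff /= -> : [set a] z by exact: distxx.
by rewrite -e; split.
Qed.

Lemma intervalC a b : interval a b = interval b a.
Proof.
by rewrite eqEsubset; split=> z; rewrite /interval /=; tri a z b; lia.
Qed.

Definition triangle a b c := [/\ apart a b c, apart b a c & apart c a b].

Lemma metric_triangle_apart a b c : metric_triangle a b c -> triangle a b c.
Proof.
case=> ea eb ec; split; apply: interval_setI1 => //.
  by rewrite (intervalC b a).
by rewrite (intervalC c a) (intervalC c b).
Qed.

Lemma exists_apart a b c : exists z,
  [/\ dist a z + dist z b = dist a b,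
    dist a z + dist z c = dist a c & apart z b c].
Proof.
have [||z [zb zc] zmax] := @exists_farthest G
    (fun z => dist a z + dist z b = dist a b /\ dist a z + dist z c = dist a c)
    (dist a) (dist a b) a.
- by rewrite distxx.
- by move=> z; lia.
exists z; split=> // s sb sc; have := zmax s.
tri a z s; tri a s b; tri a s c; lia.
Qed.

Lemma quasi_median a b c : exists a' b' c',
  [/\ triangle a' b' c',
      dist a a' + dist a' b' + dist b' b = dist a b,
      dist a a' + dist a' c' + dist c' c = dist a c &
      dist b b' + dist b' c' + dist c' c = dist b c].
Proof.
have [a' [ab ac aA]] := exists_apart a b c.
have [b' [ba bc bA]] := exists_apart b a' c.
have [c' [ca cb cA]] := exists_apart c a' b'.
exists a', b', c'; tri a a' b'; tri a a' b; tri a' b' b; tri a' c' c;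
  tri b b' c; tri b' c' c; tri a a' c.
tri b' b c; tri a b c => *.
split; [|lia..]; split.
- by move=> z z1 z2; apply: aA; tri a' z b; tri a' z c; tri z b' b;
  tri z c' c; lia.
- move=> z z1 z2; apply: bA; tri b' z c; tri z c' c; lia.
- exact: cA.
Qed.

End Geodesics.

(** * Local consequences of convex balls: triangles and pentagons *)

Section ConvexBalls.
Variables (G : graph) (hG : convex_balls G).
Implicit Types a b c x y z u v w r s t : G.

Lemma ball_interval u n x y z : dist u x <= n -> dist u y <= n ->
  dist x z + dist z y = dist x y -> dist u z <= n.
Proof. by move=> xn yn zxy; apply: (hG (y := x) (z := y)). Qed.

(** Otherwise [v] lies on a geodesic between two vertices of a ball around [u] that misses [v]. *)
Lemma interval_neighbors u v x y : dist v x = 1 -> dist v y = 1 ->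
  dist u x + 1 = dist u v -> dist u y + 1 = dist u v -> dist x y <= 1.
Proof.
move=> vx vy ux uy; rewrite leqNgt; apply/negP => lt1.
have := @ball_interval u (dist u x) x y v; tri x v y; lia.
Qed.

Lemma square_diagonal x y z t : dist x y = 1 -> dist y z = 1 -> dist z t = 1 ->
  dist t x = 1 -> dist x z <= 1 \/ dist y t <= 1.
Proof.
move=> xy yz zt tx; have := @ball_interval x 1 y t z; tri y z t; tri y x t; lia.
Qed.

(** One rotation of the odd cycle: the edge [u v] is now opposite [y]. A neighbor of [y] towards
    both [u] and [v] would, like [x], be closer to [v], hence adjacent to [x], and would lie on
    geodesics from [u] to both [x] and [y]. *)
Lemma rotate_apart x y u v : dist x y = 1 -> 2 <= dist u x ->
  dist u y = dist u x -> apart u x y -> dist u v = 1 ->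
    dist v x + 1 = dist u x ->
  dist y v = dist y u /\ apart y u v.
Proof.
move=> xy ux uy A uv vx.
have yv : dist y v = dist y u by have := A v; tri u v y; tri v x y; lia.
split=> // b bu bv; apply/eqP; rewrite -leqn0 leqNgt; apply/negP => b_gt0.
have [y' [yy' y'b]] := dist_split b_gt0.
have y'x : dist y' x <= 1.
  by apply: (@interval_neighbors v y); tri y y' v; tri y' b v; tri y x v;
    tri u y v; lia.
have := A y'; tri y y' u; tri y' b u; tri y' x u; tri x y u; lia.
Qed.

Lemma no_long_apart_edge x y u : dist x y = 1 -> 3 <= dist u x ->
  dist u y = dist u x -> apart u x y -> False.
Proof.
move=> xy ux uy A.
have /dist_split[v [uv vy]] : 1 <= dist u y by lia.
have /dist_split[q [vq qy]] : 1 <= dist v y by lia.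
have /dist_split[y' [yy' y'q]] : 1 <= dist y q by tri v q y; lia.
have /dist_split[x' [xx' x'u]] : 1 <= dist x u by tri x u y; lia.
have [xv Ax] : dist x v = dist x u /\ apart x u v.
  by apply: (@rotate_apart y x u v); (exact: apart_sym || (tri x y u; lia)).
have [vx' Av] : dist v x' = dist v x /\ apart v x x'.
  by apply: (@rotate_apart u v x x'); (exact: Ax || (tri x v u; tri x' x u;
    lia)).
have [x'q _] : dist x' q = dist x' v /\ apart x' v q.
  apply: (@rotate_apart x x' v q) => //; first by tri x v u; lia.
  by tri q y x; tri x v u; tri x y u; tri v y u; tri q v x; lia.
(* The rotations give [dist x' q = dist u x]. But [x'] and [y'] lie in this ball and [x] does not,
   so they are at most 2 apart, and going from [x'] to [q] through [y'] is shorter. *)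
have := @ball_interval u (dist u x).-1 x' y' x.
tri x' x y'; tri x y y'; tri x' x u; tri x' v x; tri y' y q; tri x' y' q;
  tri v q y; tri y' q u; tri u v q; tri y' y u; lia.
Qed.

Definition no_triangle x y u : Prop := forall t,
  dist x t = 1 -> dist y t = 1 -> dist u t + 1 = dist u x -> False.

(** The last common vertex of the geodesics from [u] is at distance at most 2 from the edge, and
    distance 1 would give a triangle. *)
Lemma triangle_pentagon x y u : dist x y = 1 -> dist u y = dist u x ->
  no_triangle x y u ->
  exists z, [/\ dist x z = 2, dist y z = 2 & dist u z + 2 = dist u x].
Proof.
move=> xy uy N; have [z [zx zy A]] := exists_apart u x y.
have [z3|z2] := leqP 3 (dist z x).
  by case: (@no_long_apart_edge x y z) => //; lia.
exists z; have := N z; tri x y z; tri u x z; tri u y z => *.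
split; lia.
Qed.

Lemma pentagon_through x w y u : dist x w = 1 -> dist w y = 1 -> dist x y = 2 ->
  dist u w = dist u x -> dist u y + 1 = dist u x -> no_triangle x w u ->
  exists z, [/\ dist y z = 1, dist x z = 2 & dist u z + 2 = dist u x].
Proof.
move=> xw wy xy uw uy N; have [a [ax ay A]] := exists_apart u x y.
have aw : dist a w = dist a x by tri u a w; tri a w y; lia.
have Na : no_triangle x w a by move=> t xt wt at_; apply: (N t) => //;
  tri u a t; tri u t x; lia.
have [a2|a3] := leqP (dist a x) 2.
  exists a; tri a x y; tri u a x; tri u a y; split; lia.
have [z [xz wz az]] := triangle_pentagon xw aw Na.
(* This case is impossible: [c] and [e] both lead from [a] to [w], so they are adjacent or equal.
   Then [p] and [w] both lead from [x] to [e], so they are adjacent, and [p] contradicts [Na]. *)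
have /dist_split[c [ac cz]] : 1 <= dist a z by lia.
have /dist_split[e [ae ey]] : 1 <= dist a y by lia.
have /dist_split[p [xp pz]] : 1 <= dist x z by lia.
have ex : dist e x = dist a x by have := A e; tri a e x; tri e y x; lia.
have ce : dist c e <= 1.
  by apply: (@interval_neighbors w a) => //; [tri c z w|tri e y w]; tri a c w;
    tri a e w; tri w a x; lia.
have pw : dist p w <= 1.
  apply: (@interval_neighbors e x) => //.
    by tri e c p; tri c z p; tri e p x; lia.
  by tri e y w; tri e w x; lia.
have pw0 : dist p w <> 0 by tri p w z; lia.
by have := Na p; tri a c z; tri p z a; tri x p a; tri p w x; lia.
Qed.

(** * Pentagons at a corner of a metric triangle *)

Definition balanced k n m : Prop :=
  (k = n /\ n = m) \/ (k = 2 /\ n = 2 /\ m = 1) \/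
  (k = 2 /\ n = 1 /\ m = 2) \/ (k = 1 /\ n = 2 /\ m = 2).

(* The pentagon [b p q s t] at the corner [b] of a triangle [a b c], with [q] on
   the side [b a] and [s] on the side [b c]. *)
Definition corner a b c p q s t : Prop :=
  [/\ [/\ dist b p = 1, dist p q = 1, dist q s = 1,
    dist s t = 1 & dist t b = 1],
      dist b q = 2 /\ dist q a + 2 = dist b a &
      dist b s = 2 /\ dist s c + 2 = dist b c].

Lemma triangle_flip a b c : triangle a b c -> triangle c b a.
Proof. by case=> A B C; split; exact: apart_sym. Qed.

Lemma corner_flip a b c p q s t : corner a b c p q s t -> corner c b a t s q p.
Proof.
by case=> [[bp pq qs st tb] [bq qa] [bs sc]]; split=> //; split=> //;
  rewrite dist_sym.
Qed.

Lemma corner_dist a b c p q s t : triangle a b c -> corner a b c p q s t ->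
  [/\ dist q c + 1 = dist b c, dist p c = dist b c & 2 <= dist p t].
Proof.
move=> [A B C] [[bp pq qs st tb] [bq qa] [bs sc]].
have qc : dist q c + 1 = dist b c by have := B q; tri b q c; tri q s c; lia.
have pc : dist p c = dist b c.
  by have := B p; tri p q c; tri b p c; tri b p a; tri p q a; lia.
have ps : 2 <= dist p s by have := B p; tri b p s; tri p s c; tri b p a;
  tri p q a; lia.
have qt : 2 <= dist q t by have := B t; tri b t q; tri q t a; tri b t a;
  tri b t c; tri t s c; lia.
split=> //; rewrite ltnNge; apply/negP => pt.
have : dist p t <> 0 by tri p t s; lia.
have := @square_diagonal p q s t; tri t p q; lia.
Qed.

(* The neighbors [p] and [t] of [b] would both be closer to the neighbor of [c]
   on [c p] and [c a]. *)
Lemma corner_apart a b c p q s t : triangle a b c -> corner a b c p q s t ->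
  3 <= dist b c -> apart c p a.
Proof.
move=> T K bc3; have [qc pc pt] := corner_dist T K.
move: T K => [A B C] [[bp pq qs st tb] [bq qa] [bs sc]].
move=> z0 z0p z0a; apply/eqP; rewrite -leqn0 leqNgt; apply/negP => z0_gt0.
have [z [cz zz0]] := dist_split z0_gt0.
have /dist_split[e [ce es]] : 1 <= dist c s by tri c s b; lia.
have zp : dist z p + 1 = dist c p by tri c z p; tri z z0 p; tri c z0 p; lia.
have za : dist z a + 1 = dist c a by tri c z a; tri z z0 a; lia.
have ze : dist z e <= 1.
  apply: (@interval_neighbors p c) => //; first by tri p z c; lia.
  by tri p e c; tri e s p; tri p q s; tri c s b; lia.
have zb : dist z b = dist c b.
  by have := C z; tri z e b; tri e s b; tri c z b; tri c s b; lia.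
have zt : dist z t + 1 = dist z b by tri z e t; tri e s t; tri z t b;
  tri c s b; lia.
have : dist p t <= 1.
  by apply: (@interval_neighbors z b) => //; tri z t b; tri p z c; tri b z c;
    lia.
lia.
Qed.


Definition smaller_balanced N : Prop := forall x y z, triangle x y z ->
  dist x y + dist y z + dist x z < N ->
  balanced (dist x y) (dist y z) (dist x z).

(** Moving [b] to [p] shortens the side to [a] by one and keeps the side to [c]. The quasi-median of
    [a], [c], [p] fixes [a] and [c]; [l] is the distance from [p] to its third vertex. *)
Lemma corner_sides a b c p q s t : triangle a b c -> corner a b c p q s t ->
  smaller_balanced (dist a b + dist b c + dist a c) -> 3 <= dist b c ->
  exists i j l : nat, [/\ i + l = dist b c,
    j + l + 1 = dist a b & balanced (dist a c) i j].
Proof.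
move=> T K IH bc3; have [qc pc _] := corner_dist T K.
have := corner_apart T K bc3.
move: T K => [A B C] [[bp pq qs st tb] [bq qa] [bs sc]] D.
have [a1 [c1 [p1 [T1 ac ap cp]]]] := quasi_median a c p.
have pa : dist p a + 1 = dist b a by tri p q a; tri b p a; lia.
have aa1 : dist a a1 = 0.
  by apply: A; tri a a1 b; tri a1 p1 p; tri a1 p b; tri a1 c1 c; tri a1 c a;
    tri a p b; lia.
have cc1 : dist c c1 = 0.
  by apply: D; tri c1 p1 p; tri a1 c1 a; tri c1 p c; tri a c1 c; lia.
exists (dist c1 p1), (dist a1 p1), (dist p p1).
have -> : dist a c = dist a1 c1 by tri a c1 c; lia.
split; [tri c p b; tri p p1 c; lia|tri p p1 a; tri a p b; lia|].
apply: IH => //; tri c p b; tri a p b; lia.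
Qed.

(** Here [b] moves to [s], and [y] is the third vertex of the quasi-median of [a], [c], [s]. Its
    sides at [y] differ by one, which forces type (2,2,1). *)
Lemma corner_base a b c p q s t : triangle a b c -> corner a b c p q s t ->
  smaller_balanced (dist a b + dist b c + dist a c) ->
  3 <= dist b c -> dist a b = dist b c -> dist a c = 2 ->
  exists y, [/\ dist y c = 1, dist a y = 2 & dist s y + 3 = dist b c].
Proof.
move=> T K IH bc3 ab ac2; have [T' K'] := (triangle_flip T, corner_flip K).
have [sa ta _] := corner_dist T' K'.
have D : apart a t c by apply: (corner_apart T' K'); tri a b c; lia.
move: T K {T' K'} => [A B C] [[bp pq qs st tb] [bq qa] [bs sc]].
have [a1 [c1 [y [T1 ac as_ cs]]]] := quasi_median a c s.
have aa1 : dist a a1 = 0.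
  by apply: D; tri a a1 t; tri a1 y s; tri a1 s t; tri a s t; tri a1 c1 c;
    tri a1 c a; tri a y a1; tri a s a1; tri a b c; tri a t b; tri a s b; lia.
have cc1 : dist c c1 = 0.
  by apply: C; tri c1 y s; tri a1 c1 a; tri c1 s c; tri a c1 c; tri c1 s b;
    tri c1 b c; tri c s b; lia.
exists y; have : balanced (dist a1 c1) (dist c1 y) (dist a1 y).
  by apply: IH => //; tri a s b; tri c s b; lia.
have e1 := dist0_eq aa1; have e2 := dist0_eq cc1; subst a1 c1.
rewrite /balanced; tri a s b; tri c s b; tri a y c; tri a y s; tri c y s;
  tri a b c => *.
split; lia.
Qed.

Lemma corner_balanced a b c p q s t : triangle a b c -> corner a b c p q s t ->
  smaller_balanced (dist a b + dist b c + dist a c) ->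
  (dist a b = 2 /\ dist b c = 2 /\ dist a c = 1) \/
  (dist a b = 3 /\ dist b c = 3 /\ dist a c = 2 /\ dist q a = 1 /\ dist s c = 1).
Proof.
move=> T K IH; have [T' K'] := (triangle_flip T, corner_flip K).
have IH' : smaller_balanced (dist c b + dist b a + dist c a).
  by move=> x y z Txyz lt; apply: IH => //; tri a b c; lia.
have [qc pc _] := corner_dist T K; have [sa ta pt] := corner_dist T' K'.
have S := corner_sides T K IH; have S' := corner_sides T' K' IH'.
have E := corner_base T K IH; have E' := corner_base T' K' IH'.
move: T K {T' K'} => [A B C] [[bp pq qs st tb] [bq qa] [bs sc]].
have [bc3|bc2] := leqP 3 (dist b c); last first.
  (* Now [s = c], so [q] lies in both intervals at [a] and equals [a]. *)
  by have := A q; tri a b c; tri a q b; tri a q c; tri a s c; tri b s c;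
    tri q s c; left; lia.
have [ba3|ba2] := leqP 3 (dist b a); last first.
  by have := C s; tri a b c; tri c s b; tri a s c; tri a q c; tri b q a;
    tri a q s; left; lia.
(* Sides of a balanced triangle differ by at most 1, so [S] gives [dist b c <= dist a b] and [S']
   the converse. Equality means [i = j + 1], which is type (2,2,1) with [dist a c = 2]. *)
have [ab ac] : dist a b = dist b c /\ dist a c = 2.
  have [i [j [r [ir jr]]]] := S bc3; have [i' [j' [r' [ir' jr']]]] := S' ba3.
  by rewrite /balanced; tri a b c; lia.
have [y [yc ay sy]] := E bc3 ab ac.
have {}E' : exists x, [/\ dist x a = 1, dist c x = 2 & dist q x + 3 = dist b a].
  by apply: E'; tri a b c; lia.
have [x [xa cx qx]] := E'; right.
have xy : dist x y <= 2.
  rewrite leqNgt; apply/negP => xy3.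
  have := @ball_interval b (dist b a).-1 x y a.
  by tri x a y; tri b x a; tri b q x; tri b s y; tri b y c; lia.
have bx : dist b x + 1 = dist b a by tri b q x; tri b x a; lia.
have bY : dist b y + 1 = dist b c by tri b s y; tri b y c; lia.
(* This quasi-median fixes [b]. As [x] and [y] are at most 2 apart and both at distance
   [dist a b - 1] from [b], it can be balanced only if [dist a b = 3]. *)
have [b1 [x1 [y1 [T1 bx1 by1 xy1]]]] := quasi_median b x y.
have b0 : dist b b1 = 0.
  by apply: B; tri b b1 x; tri b b1 y; tri b1 x1 x; tri b1 y1 y; tri b1 x a;
    tri b1 y c; tri b b1 a; tri b b1 c; lia.
have : balanced (dist b1 x1) (dist x1 y1) (dist b1 y1).
  by apply: IH => //; tri a b c; lia.
rewrite /balanced => bal.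
have b3 : dist b a = 3.
  by clear -ba3 ab xy bx bY bx1 by1 xy1 b0 bal; tri x x1 b; tri a b c; lia.
by tri a b c; tri s y c; tri q x a; clear bal; lia.
Qed.

Lemma corner_far a b c p q s t f : triangle a b c -> corner a b c p q s t ->
  dist b c = 3 -> dist a c = 2 -> dist a f = 1 -> dist f c = 1 -> 3 <= dist f p.
Proof.
move=> T K bc ac af fc; have [_ pc _] := corner_dist T K.
by have := corner_apart T K _ (z := f); tri c f p; tri c f a; tri b c p; lia.
Qed.

Lemma corner_fill a b c p q s t f : triangle a b c -> corner a b c p q s t ->
  dist a b = 3 -> dist b c = 3 -> dist a c = 2 -> dist q a = 1 ->
    dist s c = 1 ->
  dist a f = 1 -> dist f c = 1 ->
  exists z, [/\ dist q z = 1, dist f z = 1, dist b z = 2,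
    dist a z = 1 & dist q f = 2].
Proof.
move=> T K ab bc ac qa sc af fc; have fp := corner_far T K bc ac af fc.
(* Any common neighbor of [b] and [q] can replace [p] in the corner. *)
have far r : dist b r = 1 -> dist r q = 1 -> 3 <= dist f r.
  move=> br rq; apply: (@corner_far a b c r q s t) => //.
  by case: K => [[? ? ? ? ?] ? ?].
move: T K => [A B C] [[bp pq qs st tb] [bq _] [bs _]].
have fb : dist f b = 3.
  have := @ball_interval b 3 a c f; have := A f.
  by tri a b c; tri a f b; tri a f c; lia.
have qf : dist q f = 2 by tri q a f; tri p q f; lia.
have N : no_triangle b p f.
  move=> r br pr fr; have := far r br.
  have : dist q r <= 1 by apply: (@interval_neighbors f p) => //; tri p q f;
    lia.
  have : dist q r <> 0 by move/dist0_eq => e; subst r; lia.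
  by tri q r f; lia.
have [z [qz bz fz]] : exists z, [/\ dist q z = 1,
  dist b z = 2 & dist f z + 2 = dist f b].
  by apply: (pentagon_through bp pq bq); tri p q f; tri q f p => *;
    [lia|lia|apply: N].
exists z; have := @square_diagonal a q z f.
by tri a q z; tri a z b; tri a f z; tri q f a; split; lia.
Qed.

(** With [f] the midpoint of [a] and [c], [corner_fill] on both sides gives [z] and [y], adjacent
    since both lead from [f] to [b]. A diagonal of the square [q s y z] creates a square [z s c f]
    or [y q a f] with no diagonal. *)
Lemma no_corner_332 a b c p q s t : triangle a b c -> corner a b c p q s t ->
  dist a b = 3 -> dist b c = 3 -> dist a c = 2 -> dist q a = 1 ->
    dist s c = 1 -> False.
Proof.
move=> T K ab bc ac qa sc.
have /dist_split[f [af fc]] : 1 <= dist a c by lia.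
have [z [qz fz bz az qf]] : exists z,
  [/\ dist q z = 1, dist f z = 1, dist b z = 2, dist a z = 1 & dist q f = 2].
  by apply: corner_fill T K _ _ _ _ _ _ _; lia.
have [y [sy fy bY cy sf]] : exists z,
  [/\ dist s z = 1, dist f z = 1, dist b z = 2, dist c z = 1 & dist s f = 2].
  by apply: (corner_fill (triangle_flip T) (corner_flip K)); tri a b c;
    tri f c a; lia.
have [_ sa _] := corner_dist (triangle_flip T) (corner_flip K).
have [qc _ _] := corner_dist T K.
move: T K => [A B C] [[bp pq qs st tb] [bq _] [bs _]].
have zc : 2 <= dist z c by have := A z; tri a z b; tri a z c; tri a b z; lia.
have ya : 2 <= dist y a by have := A y; tri a y b; tri a y c; tri a b y;
  tri c y b; lia.
have bf : dist b f = 3 by have := A f; tri a f b; tri a f c; tri f z b; lia.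
have zy : dist z y = 1.
  have : dist z y <= 1 by apply: (@interval_neighbors b f) => //; lia.
  by tri z y c; lia.
have [zs|yq] : dist z s <= 1 \/ dist y q <= 1.
  by apply: square_diagonal; tri s y q; tri q s z; lia.
  have := @square_diagonal z s c f; tri z s c; tri f c z; lia.
have := @square_diagonal y q a f; tri y q a; tri a f y; lia.
Qed.

Lemma corner_type a b c p q s t : triangle a b c -> corner a b c p q s t ->
  smaller_balanced (dist a b + dist b c + dist a c) ->
  dist a b = 2 /\ dist b c = 2 /\ dist a c = 1.
Proof.
move=> T K IH; have [//|[ab [bc [ac [qa sc]]]]] := corner_balanced T K IH.
by case: (no_corner_332 T K).
Qed.

(** * Finding a corner when the triangle is not strongly equilateral *)

Lemma corner_of_closer_vertex a b c y0 : triangle a b c ->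
  smaller_balanced (dist a b + dist b c + dist a c) -> dist a c <= dist a b ->
  dist b y0 + dist y0 c = dist b c -> dist a y0 < dist a b ->
  exists p q s t, corner a b c p q s t.
Proof.
move=> [A B C] IH acb bcy0 ay0.
have [||y [bcy ay] ymax] := @exists_farthest G
    (fun y => dist b y + dist y c = dist b c /\ dist a y < dist a b)
    (fun y => dist y c) (dist b c) y0 => //; first by move=> *; lia.
(* No vertex of [I(b, c)] is farther from [a] than [b], by convexity; the choice of [y] excludes
   closer ones before [y]. *)
have int z : dist b z + dist z y = dist b y -> dist z y <> 0 ->
  dist a z = dist a b.
  move=> zy z0; have := @ball_interval a (dist a b) b c z.
  by have := ymax z; tri b z c; tri z y c; lia.
have by1 : 1 <= dist b y by tri a b y; lia.
have [w [bw wy]] := @dist_split _ (dist b y).-1 b y ltac:(lia).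
have aw : dist a w = dist a b by apply: int; lia.
have ay1 : dist a y + 1 = dist a b by tri a w y; lia.
have by2 : 2 <= dist b y by have := B y; tri a b y; lia.
have [x [bx xw]] := @dist_split _ (dist b w).-1 b w ltac:(lia).
have xy : dist x y = 2 by tri b x y; tri x w y; lia.
have ax : dist a x = dist a b by apply: int; lia.
have N : no_triangle x w a.
  move=> r xr wr ar; have yr : dist y r <= 1.
    by apply: (@interval_neighbors a w) => //; lia.
  have := int r; have : dist y r <> 0 by move/dist0_eq => e; subst r; lia.
  by tri y r b; tri b x r; lia.
have [z [yz xz az]] : exists z, [/\ dist y z = 1,
  dist x z = 2 & dist a z + 2 = dist a x].
  by apply: (@pentagon_through x w y a) => //; lia.
have /dist_split[p [xp pz]] : 1 <= dist x z by lia.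
have [j3|j2] := leqP 3 (dist b y); last first.
  have e : dist b x = 0 by lia.
  move/dist0_eq in e; subst x; exists p, z, y, w.
  by tri b a y; tri b z a; tri y z a; tri b w y; tri b w a; split; split; lia.
have bz : dist b z = dist b y.
  have := int z; tri b z y; tri b x z; tri a z y; tri z b a; lia.
have [x1 [bx1 x1x]] := @dist_split _ 1 b x ltac:(lia).
(* A neighbor [o] of [b] towards both is adjacent or equal to [x1], yet not in [I(b, y)]. Then [z]
   and [w] both lead from [y] to [o], so [dist z w <= 1], although their distances to [a] differ by
   2. *)
have D : apart b a z.
  move=> o0 o0a o0z; apply/eqP; rewrite -leqn0 leqNgt; apply/negP => o0_gt0.
  have [o [bo oo0]] := dist_split o0_gt0.
  have oa : dist o a + 1 = dist b a by tri b o a; tri o o0 a; lia.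
  have oz : dist o z + 1 = dist b z by tri b o z; tri o o0 z; lia.
  have x1z : dist x1 z + 1 = dist b z by tri x1 x z; tri b x1 z; lia.
  have ox1 : dist o x1 <= 1 by apply: (@interval_neighbors z b) => //;
    tri o z b; tri x1 z b; lia.
  have ao : dist a o <> dist a b by tri a o b; lia.
  have yo : dist o y = dist b y.
    by have := int o; tri b o y; tri o x1 y; tri x1 x y; tri o y z; lia.
  have : dist z w <= 1.
    apply: (@interval_neighbors o y); [lia|tri y w o; lia|tri y z o; lia|].
    by tri o w y; tri o x1 w; tri x1 x w; lia.
  by tri a z w; lia.
have [a1 [b1 [z1 [T1 ab az1 bz1]]]] := quasi_median a b z.
have b0 : dist b b1 = 0.
  by apply: D; tri b b1 a; tri a1 b1 a; tri a1 b1 b; tri b1 z1 z; tri b b1 z;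
    tri a a1 b; lia.
(* Since [b1 = b] and [dist a z = dist a b - 2], the first side exceeds the third by at least 2. *)
have : balanced (dist a1 b1) (dist b1 z1) (dist a1 z1).
  by apply: IH => //; tri a y c; lia.
by rewrite /balanced; tri b b1 a1; tri b z y; lia.
Qed.

(** * Case distinction and induction on the perimeter *)

Definition has_corner a b c := exists p q s t, corner a b c p q s t.

Lemma has_corner_flip a b c : has_corner a b c -> has_corner c b a.
Proof. by move=> [p [q [s [t K]]]]; exists t, s, q, p; apply: corner_flip. Qed.

Definition equidistant_apex a b c : Prop :=
  forall y, dist b y + dist y c = dist b c -> dist a y = dist a b.

Lemma triangle_swap12 a b c : triangle a b c -> triangle b a c.
Proof. by case=> A B C; split=> //; apply: apart_sym. Qed.

Lemma triangle_swap23 a b c : triangle a b c -> triangle a c b.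
Proof. by case=> A B C; split=> //; apply: apart_sym. Qed.

Lemma equidistant_or_corner a b c : triangle a b c ->
  smaller_balanced (dist a b + dist b c + dist a c) ->
  [\/ dist a b = dist a c /\ equidistant_apex a b c, has_corner a b c
    | has_corner a c b].
Proof.
wlog le_cb : b c / dist a c <= dist a b => [wl|] T IH.
  have [/wl/(_ T IH)//|lt_bc] := leqP (dist a c) (dist a b).
  have T' := triangle_swap23 T.
  have IH' : smaller_balanced (dist a c + dist c b + dist a b).
    by move=> x y z Txyz lt; apply: IH => //; tri a b c; lia.
  have [[e E]|K|K] := wl c b (ltnW lt_bc) T' IH'; [lia|exact: Or33|exact: Or32].
have [[y ybc ay]|E] := pselect (exists2 y, dist b y + dist y c = dist b c &
    dist a y < dist a b).
  by apply: Or32; apply: corner_of_closer_vertex ybc ay.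
have eq_ab y : dist b y + dist y c = dist b c -> dist a y = dist a b.
  move=> yb; have := @ball_interval a (dist a b) b c y;
    have [|] := leqP (dist a b) (dist a y); first lia.
  by move=> lt; case: E; exists y.
by apply: Or31; split=> //; apply/esym/eq_ab; rewrite distxx addn0.
Qed.

Lemma triangle_cases a b c : triangle a b c ->
  smaller_balanced (dist a b + dist b c + dist a c) ->
  [\/ [/\ equidistant_apex a b c,
    equidistant_apex b a c & equidistant_apex c a b] /\
      (dist a b = dist b c /\ dist b c = dist a c),
      has_corner a b c, has_corner b a c | has_corner a c b].
Proof.
move=> T IH; have [[eA EA]|K|K] := equidistant_or_corner T IH;
  [|by apply: Or42|by apply: Or44].
have T2 := triangle_swap12 T.
have IH2 : smaller_balanced (dist b a + dist a c + dist b c).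
  by move=> x y z Txyz lt; apply: IH => //; tri a b c; lia.
have [[eB EB]|K|K] := equidistant_or_corner T2 IH2;
  [|by apply: Or43|by apply: Or44; apply: has_corner_flip].
have T3 := triangle_swap12 (triangle_swap23 T).
have IH3 : smaller_balanced (dist c a + dist a b + dist c b).
  by move=> x y z Txyz lt; apply: IH => //; tri a b c; lia.
have [[eC EC]|K|K] := equidistant_or_corner T3 IH3;
  [|by apply: Or43; apply: has_corner_flip|by apply: Or42; apply:
    has_corner_flip].
by apply: Or41; split=> //; tri a b c; lia.
Qed.

Lemma triangle_balanced N : smaller_balanced N.
Proof.
elim/ltn_ind: N => N IH a b c T lt_N.
have IHT := IH _ lt_N; rewrite /balanced.
have [[_ ?]|K|K|K] := triangle_cases T IHT; first by left.
all: case: K => p [q [s [t K]]].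
- by have := corner_type T K IHT; tri a b c; lia.
- have := corner_type (triangle_swap12 T) K.
  have -> : dist b a + dist a c + dist b c = dist a b + dist b c + dist a c.
    by tri a b c; lia.
  by move/(_ IHT); tri a b c; lia.
- have := corner_type (triangle_swap23 T) K.
  have -> : dist a c + dist c b + dist a b = dist a b + dist b c + dist a c.
    by tri a b c; lia.
  by move/(_ IHT); tri a b c; lia.
Qed.

End ConvexBalls.

(** * The pentagon on a triangle of type (2,2,1) *)

Lemma induced_pentagon (G : graph) (u v x w y : G) :
  dist u v = 1 -> dist v x = 1 -> dist x w = 1 -> dist w y = 1 ->
    dist y u = 1 ->
  1 < dist u x -> 1 < dist v w -> 1 < dist x y -> 1 < dist w u ->
    1 < dist y v ->
  pentagon u v x w y.
Proof.
move=> uv vx xw wy yu ux vw xy wu yv.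
have := (dist_sym u v, dist_sym v x, dist_sym x w, dist_sym w y, dist_sym y u).
have := (dist_sym u x, dist_sym v w, dist_sym x y, dist_sym w u, dist_sym y v).
move=> [[[[S1 S2] S3] S4] S5] [[[[S6 S7] S8] S9] S10].
have eq0 (a b : G) : a = b -> dist a b = 0 by move=> ->; apply: distxx.
split.
  case=> [[|[|[|[|[|//]]]]] hi] [[|[|[|[|[|//]]]]] hj];
  rewrite !(tnth_nth u) /= => /eq0 e; apply/val_inj => //=; lia.
case=> [[|[|[|[|[|//]]]]] hi] [[|[|[|[|[|//]]]]] hj];
rewrite !(tnth_nth u) adj_dist -!val_eqE /= ?distxx //; lia.
Qed.

Lemma corner_pentagon (G : graph) (hG : convex_balls G) (a b c p q s t : G) :
  triangle a b c -> corner a b c p q s t -> dist b a = 2 -> dist b c = 2 ->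
  dist a c = 1 -> pentagon a c t b p.
Proof.
move=> T K ba bc ac; have [_ pc pt] := corner_dist hG T K.
have [_ ta _] := corner_dist hG (triangle_flip T) (corner_flip K).
move: K => [[bp pq qs st tb] [bq qa] [bs sc]].
have /dist0_eq e : dist q a = 0 by lia.
have /dist0_eq e' : dist s c = 0 by lia.
subst q s; have := dist_sym a t; have := dist_sym b c; have := dist_sym p t.
by move=> *; apply: induced_pentagon; lia.
Qed.

Theorem theorem7p1 (G : graph) (hG : convex_balls G) (u v w : G)
    (huvw : metric_triangle u v w)
    (hle : dist u v <= dist u w <= dist v w) :
  strongly_equilateral u v w \/
  (triangle_type u v w = [:: 2; 2; 1] /\ exists x y : G, pentagon u v x w y).
Proof.
have T := metric_triangle_apart huvw.
have [uv_uw uw_vw] := andP hle.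
have IH N : smaller_balanced G N by apply: triangle_balanced.
have [[[eU eV eW] [e1 e2]]|K|K|K] := triangle_cases hG T (IH _).
- by left; split=> // x y;
  [move=> /eU-> /eU->|move=> /eV-> /eV->|move=> /eW-> /eW->].
(* The two sides of length 2 meet at the corner, so the order of the side lengths allows a corner
   only at [w]. *)
- case: K => p [q [s [t K]]]; have := corner_type hG T K (IH _).
  by tri u v w; lia.
- case: K => p [q [s [t K]]];
  have := corner_type hG (triangle_swap12 T) K (IH _).
  by tri u v w; lia.
case: K => p [q [s [t K]]]; right.
have [uw [wv uv]] := corner_type hG (triangle_swap23 T) K (IH _).
have vw : dist v w = 2 by rewrite dist_sym.
split; first by rewrite /triangle_type uv uw vw.
exists t, p; apply: (corner_pentagon hG (triangle_swap23 T) K) => //.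
by rewrite dist_sym.
Qed.
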